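(* Let $\bar x\in\mathbf V$ be a fixed point of every $\mathbf S_i$, $i=1,\dots,d$. Assume that all maps $\mathbf P_i$ and $\mathbf S_i$ are continuously (Fréchet) differentiable in a neighborhood of $\bar x$, and that $f$ is twice continuously (Fréchet) differentiable in a neighborhood of $\bar x$. Assume that for every $i=1,\dots,d$ the operator $\bar{\mathbf P}_i\bar{\mathbf A}\bar{\mathbf P}_i$, considered as an operator on $T_i(\bar x)$, is invertible, with inverse $\bar{\mathbf B}_i$. Then the derivative of $\mathbf S=\mathbf S_d\circ\dots\circ\mathbf S_1$ at $\bar x$ is $$\mathbf S'(\bar x)=\mathbf S_d'(\bar x)\,\mathbf S_{d-1}'(\bar x)\cdots\mathbf S_1'(\bar x)=\big[(\mathbf I-\bar{\mathbf P}_d^{\bar{\mathbf A}})-\bar{\mathbf B}_d\bar{\mathbf N}_d\big]\cdots\big[(\mathbf I-\bar{\mathbf P}_1^{\bar{\mathbf A}})-\bar{\mathbf B}_1\bar{\mathbf N}_1\big].$$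
   Context: Setting: $\mathbf V$ is a real Hilbert space and $f:\mathbf V\to\mathbb R$ is a $C^1$ function with gradient $\nabla f$. To every $x\in\mathbf V$ are attached closed subspaces $T_1(x),\dots,T_d(x)$ of $\mathbf V$ (possibly overlapping) and the subspace $T(x)=T_1(x)+\dots+T_d(x)$, also assumed closed. $\mathbf P_i(x)$ denotes the orthogonal projection onto $T_i(x)$, giving maps $\mathbf P_i:\mathbf V\to\mathcal L(\mathbf V)$, and $\mathbf P(x)$ is the orthogonal projection onto $T(x)$. The (nonlinear) operators $\mathbf S_i$ on $\mathbf V$, $i=1,\dots,d$, are such that $y=\mathbf S_i(x)$ satisfies $y\in x+T_i(x)$ and $\mathbf P_i(x)\nabla f(y)=0$. Put $\mathbf S=\mathbf S_d\circ\dots\circ\mathbf S_1$. Notation at $\bar x$: $\bar{\mathbf P}_i=\mathbf P_i(\bar x)$; $\bar{\mathbf A}$ is the Hessian of $f$ at $\bar x$, viewed as a bounded self-adjoint operator on $\mathbf V$ (the derivative of $\nabla f$ at $\bar x$); $\bar{\mathbf B}_i=(\bar{\mathbf P}_i\bar{\mathbf A}\bar{\mathbf P}_i)^{-1}$, the inverse being taken on $T_i(\bar x)$; $\bar{\mathbf P}_i^{\bar{\mathbf A}}=\bar{\mathbf B}_i\bar{\mathbf P}_i\bar{\mathbf A}$; $\mathbf P_i'(\bar x;h)\in\mathcal L(\mathbf V)$ is the derivative of $\mathbf P_i$ at $\bar x$ applied to $h$; and $\bar{\mathbf N}_i$ is the linear operator on $\mathbf V$ given by $\bar{\mathbf N}_ih=\mathbf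 P_i'(\bar x;h)\nabla f(\bar x)$ (its values lie in $T_i(\bar x)$ under the assumptions made, so $\bar{\mathbf B}_i\bar{\mathbf N}_i$ is well defined). $\mathbf I$ is the identity on $\mathbf V$. *)

(* Defs.v *)
From HB Require Import structures.
From mathcomp Require Import all_boot all_order all_algebra sesquilinear.
From mathcomp Require Import boolp classical_sets functions reals topology.
From mathcomp Require Import normedtype landau derive.

Set Implicit Arguments.
Unset Strict Implicit.
Unset Printing Implicit Defensive.

Import Order.TTheory GRing.Theory Num.Theory.
Import numFieldNormedType.Exports.

Local Open Scope classical_set_scope.
Local Open Scope ring_scope.

Section BoundedLinear.
Context {R : realType} (V W : normedModType R).

Definition bounded_linear : {pred V -> W} :=
  [pred f : V -> W | `[< linear f /\ continuous f >]].

Record bounded_op :=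
  BoundedOp { op_fun :> V -> W ; op_funP : op_fun \in bounded_linear }.

HB.instance Definition _ := [isSub for op_fun].
HB.instance Definition _ := [Choice of bounded_op by <:].

Lemma bounded_linearP (f : V -> W) :
  reflect (linear f /\ continuous f) (f \in bounded_linear).
Proof. exact: asboolP. Qed.

Lemma bounded_linear_submod_closed : submod_closed bounded_linear.
Proof.
split.
  apply/bounded_linearP; split; last exact: cst_continuous.
  by move=> a u v; rewrite /= scaler0 addr0.
move=> a f g /bounded_linearP[lf cf] /bounded_linearP[lg cg].
apply/bounded_linearP; split.
  move=> b u v; rewrite !fctE lf lg !scalerDr !scalerA [a * b]mulrC.
  by rewrite -!addrA; congr (_ + _); rewrite addrCA.
move=> x; apply: cvgD; last exact: cg.
by apply: cvgZl_tmp; exact: cf.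
Qed.

HB.instance Definition _ :=
  GRing.isSubmodClosed.Build R (V -> W) bounded_linear
    bounded_linear_submod_closed.
HB.instance Definition _ := [SubChoice_isSubLmodule of bounded_op by <:].


Lemma op_is_linear (A : bounded_op) : linear A.
Proof. by have /bounded_linearP[] := op_funP A. Qed.

Lemma op_continuous (A : bounded_op) : continuous A.
Proof. by have /bounded_linearP[] := op_funP A. Qed.

HB.instance Definition _ (A : bounded_op) :=
  GRing.isLinear.Build R V W *:%R (op_fun A) (@op_is_linear A).

Lemma bounded_opP (A B : bounded_op) : A =1 B -> A = B.
Proof. by move=> AB; apply/val_inj/funext. Qed.

Definition op_norm (A : bounded_op) : R :=
  sup [set `|A x| | x in [set x : V | `|x| <= 1]].

Lemma op_norm_has_sup (A : bounded_op) :
  has_sup [set `|A x| | x in [set x : V | `|x| <= 1]].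
Proof.
split; first by exists `|A 0|, 0; rewrite //= normr0.
have /linear_bounded_continuous/bounded_funP/(_ 1)[M AM] := @op_continuous A.
by exists M => _ [x /= x1 <-]; exact: AM.
Qed.

Lemma op_norm_ub (A : bounded_op) (x : V) : `|x| <= 1 -> `|A x| <= op_norm A.
Proof. by move=> x1; apply: (sup_upper_bound (op_norm_has_sup A)); exists x. Qed.

Lemma op_norm_le (A : bounded_op) (M : R) :
  (forall x, `|x| <= 1 -> `|A x| <= M) -> op_norm A <= M.
Proof.
by move=> AM; apply: ge_sup => [|_ [x /= + <-]]; [case: (op_norm_has_sup A)|exact: AM].
Qed.

Lemma ler_op_norm (A : bounded_op) (x : V) : `|A x| <= op_norm A * `|x|.
Proof.
have [->|x0] := eqVneq x 0; first by rewrite linear0 !normr0 mulr0.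
have nx0 : 0 < `|x| by rewrite normr_gt0.
rewrite -ler_pdivrMr// mulrC -[X in X * _]ger0_norm ?invr_ge0// -normrZ -linearZ.
by apply: op_norm_ub; rewrite normrZ normfV normr_id mulVf// gt_eqF.
Qed.

Lemma op_norm_triangle (A B : bounded_op) :
  op_norm (A + B) <= op_norm A + op_norm B.
Proof.
apply: op_norm_le => x x1; apply: le_trans (ler_normD _ _) _.
by apply: lerD; exact: op_norm_ub.
Qed.

Lemma op_norm_ge0 (A : bounded_op) : 0 <= op_norm A.
Proof. by apply: le_trans (op_norm_ub A (x := 0) _); rewrite // normr0. Qed.

Lemma op_normZ_le (a : R) (A : bounded_op) :
  op_norm (a *: A) <= `|a| * op_norm A.
Proof.
by apply: op_norm_le => x x1; rewrite normrZ ler_wpM2l//; exact: op_norm_ub.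
Qed.

Lemma op_normZ (a : R) (A : bounded_op) : op_norm (a *: A) = `|a| * op_norm A.
Proof.
apply/eqP; rewrite eq_le op_normZ_le/=.
have [->|a0] := eqVneq a 0; first by rewrite normr0 mul0r op_norm_ge0.
rewrite -ler_pdivlMl ?normr_gt0// -normfV.
by rewrite -[A in leLHS](scalerK a0); exact: op_normZ_le.
Qed.

Lemma op_norm_eq0 (A : bounded_op) : op_norm A = 0 -> A = 0.
Proof.
move=> A0; apply: bounded_opP => x; apply/eqP; rewrite -normr_le0.
by apply: le_trans (ler_op_norm A x) _; rewrite A0 mul0r.
Qed.

HB.instance Definition _ := Lmodule_isNormed.Build R bounded_op
  op_norm_triangle op_normZ op_norm_eq0.

End BoundedLinear.

Arguments bounded_op {R} V W.
Notation "''L(' V , W )" := (bounded_op V W)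
  (at level 0, format "''L(' V ,  W )") : type_scope.

Section ContinuouslyDifferentiable.
Context {R : realType} {V W : normedModType R}.

(* The derivative of f as a map into the normed space 'L(V, W); 0 at a point
   where 'd f x is not continuous, hence never at a point of
   differentiability *)
Definition fderiv (f : V -> W) (x : V) : 'L(V, W) := insubd 0 ('d f x : V -> W).

Lemma fderivE (f : V -> W) (x : V) :
  differentiable f x -> fderiv f x = 'd f x :> (V -> W).
Proof.
move=> df; apply: insubdK; apply/bounded_linearP; split.
  exact: linearP.
exact: diff_continuous.
Qed.

Definition C1_near (f : V -> W) (x : V) : Prop :=
  \forall y \near x, differentiable f y /\ {for y, continuous (fderiv f)}.

End ContinuouslyDifferentiable.

Definition C2_near (R : realType) (V W : normedModType R) (f : V -> W) (x : V) :
  Prop := C1_near f x /\ C1_near (fderiv f) x.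

Section Hilbert.
Context {R : realType} {V : normedModType R} (ip : {dot V for idfun}).

Definition closed_subspace (E : set V) : Prop :=
  submod_closed [in E] /\ closed E.

Definition orthogonal_projection (E : set V) (P : V -> V) : Prop :=
  forall v, E (P v) /\ (forall w, E w -> ip (v - P v) w = 0).

Definition is_gradient (f : V -> R) (x g : V) : Prop :=
  differentiable f x /\ (forall h, 'd f x h = ip g h).

End Hilbert.

(* [sum_of_sets E] is E 0 + ... + E (d - 1) *)
Definition sum_of_sets (V : nmodType) (d : nat) (E : 'I_d -> set V) : set V :=
  [set \sum_(i < d) u i | u in [set u : 'I_d -> V | forall i, E i (u i)]].

(* B is the inverse of M as an operator on E; its values off E are arbitrary.
   For M bounded and linear on a closed subspace E, linearity and boundedness of
   B on E are automatic (open mapping theorem) *)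
Definition inverse_on (V : Type) (E : set V) (M B : V -> V) : Prop :=
  [/\ set_fun E E B, {in E, cancel M B} & {in E, cancel B M}].

(* [compose F] is F (d - 1) \o ... \o F 0 *)
Definition compose (V : Type) (d : nat) (F : 'I_d -> V -> V) : V -> V :=
  \big[comp/idfun]_(i < d) F (rev_ord i).

(* Main.v *)
Require Import Defs.
From HB Require Import structures.
From mathcomp Require Import all_boot all_order all_algebra sesquilinear.
From mathcomp Require Import boolp classical_sets functions reals topology.
From mathcomp Require Import normedtype landau derive.
From mathcomp Require Import ring lra.

Import Order.TTheory GRing.Theory Num.Theory.
Import numFieldNormedType.Exports.

Local Open Scope classical_set_scope.
Local Open Scope ring_scope.

(** Each step satisfies two identities that hold at every point [y]:
    [P y (S y - y) = S y - y], because [S y - y] lies in the range [T y] of the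
    projection, and [P y (gradf (S y)) = 0]. Both are differentiated at the
    fixed point by the product rule for operator application
    ([is_diff_op_apply]). In the first one the derivative of [P] is applied to
    [S x - x = 0], so the increment [w = S' h - h] lies in [T x]. The second one
    gives [P A (h + w) + N h = 0] ([diff_step]). Since [w] and [N h] lie in
    [T x], this is a linear equation for [w] with the compression [P A P], and
    inverting the latter gives [w = - B (P A h) - B (N h)]
    ([compression_solve]). The chain rule at the common fixed point then gives
    the derivative of the composition ([is_diff_compose]).

    The remaining point is that [gradf] itself is differentiable, whereas the
    smoothness of [f] speaks of its derivative as a functional. The two are
    related by the Riesz map [g |-> <g, .>], a linear isometry, and
    differentiability descends along an isometry with complete source
    ([isometry_reflects_differentiable]). *)

(** * Differentiability along linear isometries *)

(** An isometry preserves and reflects Cauchy filters, and the source is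
    complete. *)
Lemma isometry_reflects_cvg {R : realType} {V : completeNormedModType R}
    {W : normedModType R} (J : {linear V -> W}) {I : Type} (F : set_system I)
    {FF : ProperFilter F} (q : I -> V) :
  (forall v, `|J v| = `|v|) -> cvg (J (q t) @[t --> F]) -> cvg (q t @[t --> F]).
Proof.
move=> isoJ /cvg_cauchy/cauchy_ballP Jq; apply/cauchy_cvgP/cauchy_ballP => e e0.
have := Jq e e0; rewrite [X in X -> _]near_map2 [X in _ -> X]near_map2.
by apply: filterS => -[s t]/=; rewrite -!ball_normE/= -linearB isoJ.
Qed.

(** The difference quotients of [g] converge as soon as their images under [J]
    do, so the derivative of [J \o g] takes values in the range of [J] and can be
    pulled back; the remainder keeps its norm. *)
Lemma isometry_reflects_differentiable {R : realType} {U : normedModType R}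
    {V : completeNormedModType R} {W : normedModType R}
    (J : {linear V -> W}) (g : U -> V) (x : U) :
  (forall v, `|J v| = `|v|) -> differentiable (J \o g) x -> differentiable g x.
Proof.
move=> isoJ dJg.
have injJ u v : J u = J v -> u = v.
  move=> Juv; apply/eqP; rewrite -subr_eq0 -normr_eq0 -isoJ linearB Juv subrr.
  by rewrite normr0.
have cJ : continuous J.
  apply/linear_bounded_continuous/bounded_funP => r; exists r => v.
  by rewrite isoJ.
have /choice[dg dgE] : forall h, exists v, J v = 'd (J \o g) x h.
  move=> h; pose q (t : R) := t^-1 *: ((g \o shift x) (t *: h) - g x).
  have JqE : J \o q = fun t : R =>
      t^-1 *: (((J \o g) \o shift x) (t *: h) - (J \o g) x).
    by apply/funext => t; rewrite /q /= linearZ/= linearB.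
  have cJq : cvg (J (q t) @[t --> 0^']).
    by rewrite -[X in cvg (X @ _)]/(J \o q) JqE; exact: diff_derivable.
  have cq : cvg (q t @[t --> 0^']).
    exact: isometry_reflects_cvg isoJ cJq.
  exists (lim (q t @[t --> 0^'])).
  rewrite -deriveE// /derive -JqE; apply/esym/cvg_lim => //.
  exact: (cvg_comp _ _ cq (cJ _)).
have lin_dg : linear dg.
  by move=> a u v; apply: injJ; rewrite linearP !dgE linearP.
pose dgL : {linear U -> V} := HB.pack dg (GRing.isLinear.Build _ _ _ _ dg lin_dg).
have cdg : continuous dgL.
  have /linear_bounded_continuous/bounded_funP bd := diff_continuous dJg.
  apply/linear_bounded_continuous/bounded_funP => r; have [M bM] := bd r.
  by exists M => v /bM; rewrite -dgE isoJ.
have dgo : g \o shift x = cst (g x) + dgL +o_ 0 id.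
  apply/eqaddoP => e e0.
  have /diff_locally/eqaddoP/(_ e e0) := dJg.
  apply: filterS => h; rewrite -isoJ.
  by rewrite !fctE /= -dgE -linearD -linearB.
by apply/diff_locallyP; rewrite (diff_unique cdg dgo).
Qed.

(** * The Riesz map and the gradient *)

(** Cauchy-Schwarz. *)
Lemma dot_norm_le {R : realType} {V : normedModType R} (ip : {dot V for idfun})
    (ip_norm : forall x : V, ip x x = `|x| ^+ 2) (u v : V) :
  `|ip u v| <= `|u| * `|v|.
Proof.
have [->|u0] := eqVneq u 0; first by rewrite linear0l !normr0 mul0r.
have [->|v0] := eqVneq v 0; first by rewrite linear0r !normr0 mulr0.
have symip : ip v u = ip u v by rewrite (hermitian_subproof v u) expr0 mul1r.
(* For s = 1 and s = -1 the right-hand side is the square of the norm of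
   |v| u + s |u| v. *)
have expand (s : R) : s ^+ 2 = 1 ->
    0 <= 2 * (`|u| * `|v|) * (`|u| * `|v| + s * ip u v).
  move=> s1; have := ip_norm (`|v| *: u + (s * `|u|) *: v).
  rewrite linearDl !linearDr !linearZl_LR !linearZr_LR/= !ip_norm symip.
  rewrite /GRing.scale/=.
  move=> E; have := sqr_ge0 (`|(`|v| *: u + (s * `|u|) *: v)|).
  rewrite -E; congr (_ <= _).
  transitivity (`|u| ^+ 2 * `|v| ^+ 2 * (1 + s ^+ 2) +
    2 * s * `|u| * `|v| * ip u v); first by ring.
  by rewrite s1; ring.
have := expand 1 (expr1n _ _); have := expand (-1).
rewrite sqrrN expr1n => /(_ erefl).
rewrite !pmulr_rge0 ?mulr_gt0 ?normr_gt0// => minus plus.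
by rewrite ler_norml; apply/andP; split; lra.
Qed.

Lemma riesz_bounded {R : realType} {V : normedModType R}
    (ip : {dot V for idfun}) (ip_norm : forall x : V, ip x x = `|x| ^+ 2)
    (g : V) : (ip g : V -> R) \in @bounded_linear R V R.
Proof.
apply/bounded_linearP.
have lin : linear (ip g : V -> R) by move=> a u v; rewrite linearPr.
split => //.
pose L : {linear V -> R} := HB.pack (ip g : V -> R)
  (GRing.isLinear.Build _ _ _ _ (ip g : V -> R) lin).
rewrite -[X in continuous X]/(L : V -> R).
apply/linear_bounded_continuous/bounded_funP => r; exists (`|g| * r) => v vr.
by apply: le_trans (dot_norm_le ip ip_norm g v) _; rewrite ler_wpM2l.
Qed.

Definition riesz {R : realType} {V : normedModType R}
    (ip : {dot V for idfun}) (ip_norm : forall x : V, ip x x = `|x| ^+ 2)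
    (g : V) : 'L(V, R) := BoundedOp (riesz_bounded ip ip_norm g).

Lemma riesz_linear {R : realType} {V : normedModType R}
    (ip : {dot V for idfun}) (ip_norm : forall x : V, ip x x = `|x| ^+ 2) :
  linear (riesz ip ip_norm).
Proof. by move=> a u v; apply: bounded_opP => h; rewrite /= linearPl. Qed.

HB.instance Definition _ {R : realType} {V : normedModType R}
    (ip : {dot V for idfun}) (ip_norm : forall x : V, ip x x = `|x| ^+ 2) :=
  GRing.isLinear.Build R V 'L(V, R) *:%R (riesz ip ip_norm)
    (riesz_linear ip ip_norm).

Lemma riesz_norm {R : realType} {V : normedModType R}
    (ip : {dot V for idfun}) (ip_norm : forall x : V, ip x x = `|x| ^+ 2)
    (g : V) : `|riesz ip ip_norm g| = `|g|.
Proof.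
apply/eqP; rewrite eq_le; apply/andP; split.
  apply: op_norm_le => x x1; apply: le_trans (dot_norm_le ip ip_norm g x) _.
  by rewrite ler_piMr.
have [->|g0] := eqVneq g 0; first by rewrite normr0.
have := ler_op_norm (riesz ip ip_norm g) g.
by rewrite /= ip_norm normrX normr_id expr2 ler_pM2r ?normr_gt0.
Qed.

(** The Riesz map sends the gradient field to [fderiv f]. *)
Lemma gradient_differentiable {R : realType} {V : completeNormedModType R}
    (ip : {dot V for idfun}) (ip_norm : forall x : V, ip x x = `|x| ^+ 2)
    (f : V -> R) (gradf : V -> V) (x : V) :
  (forall y, is_gradient ip f y (gradf y)) -> differentiable (fderiv f) x ->
  differentiable gradf x.
Proof.
move=> gradfP ddf.
apply: (isometry_reflects_differentiable (riesz ip ip_norm)).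
  exact: riesz_norm.
suff -> : riesz ip ip_norm \o gradf = fderiv f by [].
apply/funext => y; have [dfy dfE] := gradfP y.
by apply: bounded_opP => h; rewrite (fderivE dfy) dfE.
Qed.

(** * Product and chain rules *)

Lemma op_apply_bilinear {R : realType} {V W : normedModType R} :
  bilinear_for *:%R *:%R (fun (A : 'L(V, W)) (v : V) => A v).
Proof. by split => [v a A B|A a u v]; rewrite ?linearP. Qed.

(** [C w - A v = (C - A) w + A (w - v)], and both terms are controlled by the
    operator norm. *)
Lemma op_apply_continuous {R : realType} {V W : normedModType R} :
  continuous (fun p : 'L(V, W) * V => p.1 p.2).
Proof.
move=> [A v]; apply/subr_cvg0/norm_cvg0P.
have c1 : p.1 @[p --> nbhs (A, v)] --> A by exact: cvg_fst.
have c2 : p.2 @[p --> nbhs (A, v)] --> v by exact: cvg_snd.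
pose bound (p : 'L(V, W) * V) := `|p.1 - A| * `|p.2| + `|A| * `|p.2 - v|.
have bound0 : bound p @[p --> nbhs (A, v)] --> 0.
  have -> : 0 = `|A - A| * `|v| + `|A| * `|v - v|.
    by rewrite !subrr !normr0 mul0r mulr0 addr0.
  apply: cvgD; apply: cvgM.
  - exact: (cvg_norm (cvgB c1 (cvg_cst _))).
  - exact: cvg_norm.
  - exact: cvg_cst.
  - exact: (cvg_norm (cvgB c2 (cvg_cst _))).
apply: (@squeeze_cvgr _ _ _ _ (cst 0) bound _ _ _ (cvg_cst 0) bound0).
apply: nearW => -[C w] /=; rewrite normr_ge0/=.
have -> : C w - A v = (C - A) w + A (w - v).
  by rewrite linearB /= addrA subrK.
apply: le_trans (ler_normD _ _) _.
by apply: lerD; exact: ler_op_norm.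
Qed.

Lemma is_diff_op_apply {R : realType} {U V W : normedModType R}
    (Q : U -> 'L(V, W)) (g : U -> V) (x : U) :
  differentiable Q x -> differentiable g x ->
  is_diff x (fun y => Q y (g y))
    (fun h => Q x ('d g x h) + ('d Q x h : 'L(V, W)) (g x)).
Proof.
move=> dQ dg.
pose ev : {bilinear 'L(V, W) -> V -> W} :=
  HB.pack (fun (A : 'L(V, W)) (v : V) => A v)
    (bilinear_isBilinear.Build R 'L(V, W) V W *:%R *:%R
      (fun (A : 'L(V, W)) (v : V) => A v) op_apply_bilinear).
have dp := differentiable_pair dQ dg.
have de : differentiable (fun p => ev p.1 p.2) (Q x, g x).
  by apply: differentiable_bilin; exact: op_apply_continuous.
split; first exact: (differentiable_comp dp de).
rewrite (diff_comp dp de) diff_pair// diff_bilin//.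
exact: op_apply_continuous.
Qed.

(** Since all the [F i] fix [x], every factor of the chain rule is taken at
    [x]. *)
Lemma is_diff_compose {R : realType} {V : normedModType R} (d : nat)
    (F : 'I_d -> V -> V) (x : V) :
  (forall i, F i x = x) -> (forall i, differentiable (F i) x) ->
  is_diff x (compose F) (compose (fun i => 'd (F i) x)).
Proof.
move=> Fx dF; rewrite /compose.
suff [_ //] : (\big[comp/idfun]_(i < d) F (rev_ord i)) x = x /\
  is_diff x (\big[comp/idfun]_(i < d) F (rev_ord i))
    (\big[comp/idfun]_(i < d) ('d (F (rev_ord i)) x : V -> V)).
apply: (big_ind2 (fun G dG : V -> V => G x = x /\ is_diff x G dG)).
- by split => //; exact: is_diff_id.
- move=> G dG H dH [Gx dGx] [Hx dHx]; split; first by rewrite /= Hx Gx.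
  by apply: is_diff_comp => //; rewrite Hx.
- by move=> i _; split => //; exact/differentiableP.
Qed.

(** * Derivative of one step *)

(** [v - P v] lies in [E] and is orthogonal to [E]. *)
Lemma orthogonal_projection_id {R : realType} {V : normedModType R}
    (ip : {dot V for idfun}) (E : set V) (P : V -> V) (v : V) :
  submod_closed [in E] -> orthogonal_projection ip E P -> E v -> P v = v.
Proof.
move=> [_ linE] projP Ev; have [EPv orth] := projP v.
apply/eqP; rewrite eq_sym -subr_eq0; apply/negPn/negP.
move=> /(neq0_dnorm_gt0 (s := ip)).
rewrite orth ?ltxx//.
have /set_mem := linE (-1) _ _ (mem_set EPv) (mem_set Ev).
by rewrite scaleN1r addrC.
Qed.

(** The product rule applied to [P y (S y - y) = S y - y] and to
    [P y (G (S y)) = 0]. *)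
Lemma diff_step {R : realType} {V : normedModType R} (ip : {dot V for idfun})
    (T : V -> set V) (P : V -> 'L(V, V)) (S G : V -> V) (x h : V) :
  (forall y, submod_closed [in T y]) ->
  (forall y, orthogonal_projection ip (T y) (P y)) ->
  (forall y, T y (S y - y) /\ P y (G (S y)) = 0) -> S x = x ->
  differentiable P x -> differentiable S x -> differentiable G x ->
  T x ('d S x h - h) /\
  P x ('d G x ('d S x h)) + ('d P x h : 'L(V, V)) (G x) = 0.
Proof.
move=> subT projP stepS Sx dP dS dG.
have dGS : differentiable (G \o S) x by apply: differentiable_comp; rewrite ?Sx.
have dSI : differentiable (S \- idfun) x by exact: differentiableB.
split.
  have [_ +] := is_diff_op_apply P (S \- idfun) x dP dSI.
  have -> : (fun y => P y ((S \- idfun) y)) = S \- idfun.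
    apply/funext => y.
    exact: orthogonal_projection_id (subT y) (projP y) (stepS y).1.
  (* the term with the derivative of P vanishes as S x - x = 0 *)
  rewrite diffB// => /(congr1 (@^~ h)) /=; rewrite Sx subrr linear0 addr0.
  rewrite diff_val /= => ->; exact: (projP x _).1.
have [_ +] := is_diff_op_apply P (G \o S) x dP dGS.
have -> : (fun y => P y ((G \o S) y)) = cst 0.
  by apply/funext => y; exact: (stepS y).2.
rewrite diff_cst diff_comp ?Sx// => /(congr1 (@^~ h)) /=.
by rewrite Sx => <-.
Qed.

(** The unknown [w] and the candidate [z = - B (P A h) - B n] lie in [E] and have
    the same image under the compression [P A P], which is injective on [E].
    Only images are compared because linearity is at hand for [P A P], not for
    its inverse [B], whose values outside [E] are arbitrary. *)
Lemma compression_solve {R : realType} {V : normedModType R}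
    (ip : {dot V for idfun}) (E : set V) (P : 'L(V, V)) (A : {linear V -> V})
    (B : V -> V) (h w n : V) :
  submod_closed [in E] -> orthogonal_projection ip E P ->
  inverse_on E (fun v => P (A (P v))) B ->
  E w -> P (A (h + w)) + n = 0 -> h + w = h - B (P (A h)) - B n.
Proof.
move=> subE projP [EB MB BM] Ew; rewrite linearD linearD => eq_w.
have linE a u v : E u -> E v -> E (a *: u + v).
  by move=> Eu Ev; apply/set_mem/subE.2; exact/mem_set.
have EN v : E v -> E (- v).
  have E0 : E 0 by apply/set_mem/subE.1.
  by move=> Ev; rewrite -[- v]addr0 -scaleN1r; exact: linE.
have EPA v : E (P (A v)) by exact: (projP _).1.
(* n has to be in E, where B inverts the compression *)
have nE : n = - P (A h) - P (A w).
  by apply/eqP; rewrite -opprD -addr_eq0 addrC eq_w.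
have En : E n by rewrite nE -scaleN1r; apply: linE => //; exact: EN.
pose z := - B (P (A h)) - B n.
have Ez : E z.
  by rewrite /z -scaleN1r; apply: linE; [|apply: EN]; exact: EB.
have Mz : P (A (P z)) = P (A (P w)).
  rewrite /z !linearB !linearN/=.
  rewrite (BM _ (mem_set (EPA h))) (BM _ (mem_set En)).
  rewrite (orthogonal_projection_id ip E P w subE projP Ew) nE.
  by rewrite opprB addrC subrK.
rewrite -addrA -/z; congr (h + _).
by rewrite -(MB w (mem_set Ew)) -Mz (MB z (mem_set Ez)).
Qed.

Theorem theorem2p3 (R : realType) (V : completeNormedModType R)
  (ip : {dot V for idfun}) (ip_norm : forall x : V, ip x x = `|x| ^+ 2)
  (f : V -> R) (gradf : V -> V)
  (gradfP : forall x : V, is_gradient ip f x (gradf x))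
  (f_C1 : continuous (fderiv f))
  (d : nat) (T : 'I_d -> V -> set V)
  (T_closed : forall (i : 'I_d) (x : V), closed_subspace (T i x))
  (sumT_closed : forall x : V, closed (sum_of_sets (fun i => T i x)))
  (P : 'I_d -> V -> 'L(V, V))
  (P_proj : forall (i : 'I_d) (x : V), orthogonal_projection ip (T i x) (P i x))
  (S : 'I_d -> V -> V)
  (S_step : forall (i : 'I_d) (x : V),
    T i x (S i x - x) /\ P i x (gradf (S i x)) = 0)
  (xbar : V)
  (S_fixed : forall i : 'I_d, S i xbar = xbar)
  (P_C1 : forall i : 'I_d, C1_near (P i) xbar)
  (S_C1 : forall i : 'I_d, C1_near (S i) xbar)
  (f_C2 : C2_near f xbar)
  (B : 'I_d -> V -> V)
  (A := 'd gradf xbar : V -> V)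
  (BP : forall i : 'I_d,
    inverse_on (T i xbar) (fun h => P i xbar (A (P i xbar h))) (B i))
  (PA := fun (i : 'I_d) (h : V) => B i (P i xbar (A h)))
  (N := fun (i : 'I_d) (h : V) => ('d (P i) xbar h : 'L(V, V)) (gradf xbar)) :
  [/\ differentiable (compose S) xbar,
      'd (compose S) xbar = compose (fun i => 'd (S i) xbar) :> (V -> V) &
      compose (fun i => 'd (S i) xbar) =
      compose (fun i h => h - PA i h - B i (N i h))].
Proof.
have dP i : differentiable (P i) xbar by have [] := nbhs_singleton (P_C1 i).
have dS i : differentiable (S i) xbar by have [] := nbhs_singleton (S_C1 i).
have dG : differentiable gradf xbar.
  have [_ /nbhs_singleton[ddf _]] := f_C2.
  exact: gradient_differentiable ip_norm f gradf xbar gradfP ddf.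
have [dcomp diffcomp] := is_diff_compose d S xbar S_fixed dS.
split => //; rewrite /compose; apply: eq_bigr => i _; apply/funext => h.
move: (rev_ord i) => {}i; rewrite /PA /N.
have [Tw] := diff_step ip (T i) (P i) (S i) gradf xbar h
  (fun y => (T_closed i y).1) (P_proj i) (S_step i) (S_fixed i)
  (dP i) (dS i) dG.
set w := 'd (S i) xbar h - h in Tw *.
have -> : 'd (S i) xbar h = h + w by rewrite addrC subrK.
move=> eq_w.
exact: compression_solve (T_closed i xbar).1 (P_proj i xbar) (BP i) Tw eq_w.
Qed.
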